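(* Let $\mathcal A$ be a real Banach space and $\mathcal B=\mathcal A'$ its dual, with weak\* topology $w^*$. Let $\Theta$ be a parameter set, $\theta\mapsto f_\theta\in\mathcal B$ a parametric model with model class $\mathcal F_\Theta$, $C:\Theta\to[0,+\infty)$ a parameter cost, $R_\Theta:\mathcal B\to[0,+\infty]$ the parametric representation cost, $R$ its $w^*$-l.s.c. regularization, and $\mathcal F=\{f\in\mathcal B:R(f)<+\infty\}$. Suppose that $\mathsf A:\mathcal B\to\mathbb R^M$ is linear and $w^*$-continuous, that $G:\mathbb R^M\to\mathbb R$ is continuous, and that $\lambda>0$. Then $$\inf_{\theta\in\Theta}\big[G(\mathsf Af_\theta)+\lambda C(\theta)\big]=\inf_{f\in\mathcal F_\Theta}\big[G(\mathsf Af)+\lambda R_\Theta(f)\big]=\inf_{f\in\mathcal F}\big[G(\mathsf Af)+\lambda R(f)\big].$$ Consequently: (i) If $\theta^\star\in\Theta$ minimizes $\theta\mapsto G(\mathsf Af_\theta)+\lambda C(\theta)$ over $\Theta$, then $f_{\theta^\star}\in\mathcal F$ minimizes $f\mapsto G(\mathsf Af)+\lambda R(f)$ over $\mathcal F$. (ii) If $f^\star\in\mathcal F$ minimizes $f\mapsto G(\mathsf Af)+\lambda R(f)$ over $\mathcal F$, $f^\star\in\mathcal F_\Theta$, and $R(f^\star)=R_\Theta(f^\star)$, then $f^\star$ minimizes $f\mapsto G(\mathsf Af)+\lambda R_\Theta(f)$ over $\mathcal F_\Theta$. (iii) If, in addition to the hypotheses of (ii), there exists $\theta^\star\in\Theta$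 with $f_{\theta^\star}=f^\star$ and $C(\theta^\star)=R_\Theta(f^\star)$, then $\theta^\star$ minimizes $\theta\mapsto G(\mathsf Af_\theta)+\lambda C(\theta)$ over $\Theta$.
   Context: $w^*=\sigma(\mathcal B,\mathcal A)$. $\mathcal F_\Theta=\{f_\theta:\theta\in\Theta\}$. $R_\Theta(f)=\inf\{C(\theta):\theta\in\Theta,\ f_\theta=f\}$ for $f\in\mathcal F_\Theta$ and $R_\Theta(f)=+\infty$ for $f\in\mathcal B\setminus\mathcal F_\Theta$. A function $K:\mathcal B\to[-\infty,+\infty]$ is $w^*$-l.s.c. if all sublevel sets $\{K\le\alpha\}$, $\alpha\in\mathbb R$, are $w^*$-closed; its $w^*$-l.s.c. regularization is the largest $w^*$-l.s.c. function bounded above by $K$. *)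

(* Defs.v *)
From HB Require Import structures.
From mathcomp Require Import all_boot all_order all_algebra.
From mathcomp Require Import all_classical all_reals.
From mathcomp Require Import ereal topology normedtype.

Set Implicit Arguments.
Unset Strict Implicit.
Unset Printing Implicit Defensive.

Import Order.TTheory GRing.Theory Num.Theory.
Import numFieldNormedType.Exports.

Local Open Scope classical_set_scope.
Local Open Scope ring_scope.

Lemma initial_topology_cvgP (S : choiceType) (T : topologicalType) (f : S -> T)
    (F : set_system (initial_topology f)) (s : initial_topology f) : Filter F ->
  F --> s <-> f x @[x --> F] --> f s.
Proof.
move=> FF; split=> [Fs|fF U].
  exact: (cvg_comp _ _ Fs (@initial_continuous _ _ f s)).
rewrite nbhsE => -[_ [[B oB <-] Bs] BU].
by apply: filterS BU _; apply: fF; exact: open_nbhs_nbhs.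
Qed.

Section WeakStarDual.
Variables (R : realType) (A : normedModType R).

Definition continuous_functional : {pred A -> R^o} :=
  fun u => `[< linear u /\ continuous u >].

Lemma continuous_functional_submod : submod_closed continuous_functional.
Proof.
split=> [|k u v /asboolP[lu cu] /asboolP[lv cv]]; apply/asboolP; split.
- by move=> a x y; rewrite -[RHS]/(a *: 0 + 0) scaler0 addr0.
- by move=> x; exact: cvg_cst.
- have E z : (k *: u + v) z = k *: u z + v z by [].
  by move=> a x y; rewrite !E lu lv !scalerDr addrACA !scalerA mulrC.
- by move=> x; apply: cvgD; [apply: cvgZl_tmp; exact: cu|exact: cv].
Qed.

HB.instance Definition _ :=
  GRing.isSubmodClosed.Build R (A -> R^o) continuous_functional
    continuous_functional_submod.

Record wdual := WDual {
  wdual_fun :> A -> R^o ;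
  _ : wdual_fun \in continuous_functional }.

HB.instance Definition _ := [isSub for wdual_fun].
HB.instance Definition _ := [Choice of wdual by <:].
HB.instance Definition _ := [SubChoice_isSubLmodule of wdual by <:].

(* {ptws A -> R^o} has the topology of pointwise convergence, so this is
   sigma(A', A), the coarsest topology for which the evaluations at the points
   of A are continuous. *)
HB.instance Definition _ := Topological.copy wdual
  (initial_topology (wdual_fun : wdual -> {ptws A -> R^o})).

Lemma wdual_linear (u : wdual) : linear u.
Proof. by case: u => u /= /asboolP[]. Qed.

Lemma wdual_continuous (u : wdual) : continuous u.
Proof. by case: u => u /= /asboolP[]. Qed.

Lemma wdual_cvgP (F : set_system wdual) (u : wdual) : Filter F ->
  F --> u <-> forall x : A, v x @[v --> F] --> u x.
Proof.
move=> FF; rewrite (@initial_topology_cvgP _ {ptws A -> R^o} wdual_fun).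
rewrite (@cvg_sup _ _ (fun x : A => Topological.class
  (initial_topology (fun g : A -> R^o => g x))) _ (u : A -> R^o)).
split=> h x; have := h x;
  by rewrite (@initial_topology_cvgP (A -> R^o) R^o (fun g => g x)).
Qed.

End WeakStarDual.

Section Regularization.
Local Open Scope ereal_scope.
Variables (R : realType) (X : topologicalType).
Implicit Types K L : X -> \bar R.

Lemma lower_semicontinuous_sublevel K :
  lower_semicontinuous K <->
  forall a : R, closed [set x | K x <= a%:E].
Proof.
rewrite lower_semicontinuousP; split=> h a.
  rewrite (_ : [set x | _] = ~` [set x | a%:E < K x]); first exact/open_closedC.
  by apply/seteqP; split=> x /=; rewrite leNgt => /negP.
rewrite (_ : [set x | _] = ~` [set x | K x <= a%:E]).
  exact/closed_openC.
by apply/seteqP; split=> x /=; rewrite ltNge => /negP.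
Qed.

Definition lsc_regularization K L :=
  [/\ lower_semicontinuous L,
      forall x, L x <= K x
    & forall L', lower_semicontinuous L' -> (forall x, L' x <= K x) ->
        forall x, L' x <= L x].

Lemma lsc_regularization_exists K : exists L, lsc_regularization K L.
Proof.
exists (fun x => ereal_sup [set L x | L in [set L |
  lower_semicontinuous L /\ forall x, L x <= K x]]); split.
- move=> x a /ereal_sup_gt[_ [L [lL LK] <-]] /lL[V xV aV].
  exists V => // y /aV /lt_le_trans; apply.
  by apply: ereal_sup_ubound; exists L.
- by move=> x; apply: ge_ereal_sup => _ [L [_ LK] <-].
- by move=> L lL LK x; apply: ereal_sup_ubound; exists L.
Qed.

End Regularization.

Section ParametricCost.
Local Open Scope ereal_scope.
Variables (R : realType) (B Theta : Type).

Definition representation_cost (f : Theta -> B) (C : Theta -> R) (g : B) :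
    \bar R :=
  if g \in range f then ereal_inf [set (C t)%:E | t in [set t | f t = g]]
  else +oo.

Definition minimizes (T : Type) (J : T -> \bar R) (D : set T) (x : T) :=
  D x /\ forall y, D y -> J x <= J y.

End ParametricCost.

(* Main.v *)
(* Write h = G o A. If a <= h (f_t) + lambda C t for every t, then the
   continuous function (a - h) / lambda is bounded above by R_Theta, hence by
   its l.s.c. regularization R; that is, a <= h + lambda R everywhere. So the
   parametric and the regularized problem have the same real lower bounds. *)
Require Import Defs.
From mathcomp Require Import all_boot all_order all_algebra.
From mathcomp Require Import all_classical all_reals.
From mathcomp Require Import ereal topology normedtype.
Import Order.TTheory GRing.Theory Num.Theory.
Import numFieldNormedType.Exports.
Local Open Scope classical_set_scope.
Local Open Scope ring_scope.

(** Restricting to real bounds [a] keeps subtraction and division by [lambda] available. A finite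
    infimum of [S] is itself such a bound, and the value [-oo] is trivial. *)
Lemma le_ereal_inf_lbound (R : realType) (S T : set (\bar R)) :
  (forall a : R, lbound S a%:E -> lbound T a%:E) ->
  (ereal_inf S <= ereal_inf T)%E.
Proof.
move=> ST; have infS : lbound S (ereal_inf S) by exact: ereal_inf_lbound.
case: (ereal_inf S) infS => [a| |] infS; last exact: leNye.
  by apply: le_ereal_inf_tmp; exact: ST.
(* If the infimum of [S] is [+oo], as for an empty parameter set, every real bounds [S], hence [T],
   from below. *)
rewrite leye_eq; apply/eqP/eqyP => a _; apply: le_ereal_inf_tmp.
by apply: ST => x /infS; apply: le_trans; exact: leey.
Qed.

(** Since [a] and [h] are finite and [l] is positive, the usual rearrangement survives at both
    infinite values of [x]. It isolates the cost from the data term. *)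
Lemma lee_addl_pmul {R : realType} {a h l : R} {x : \bar R} : 0 < l ->
  (a%:E <= h%:E + l%:E * x)%E = (((a - h) / l)%:E <= x)%E.
Proof.
move=> l0; case: x => [x| |].
- by rewrite -EFinM -EFinD !lee_fin ler_pdivrMr// lerBlDl mulrC.
- by rewrite gt0_muley ?lte_fin// addey// !leey.
- by rewrite gt0_muleNy ?lte_fin// addeNy.
Qed.

Lemma continuous_lower_semicontinuous (R : realType) (X : topologicalType)
    (h : X -> R) :
  continuous h -> lower_semicontinuous (fun x => (h x)%:E).
Proof.
move=> ch x a; rewrite lte_fin => ahx.
exists [set y | a < h y]; last by move=> y; rewrite /= lte_fin.
exact: (ch x _ (lt_nbhsr ahx)).
Qed.

Lemma le_lsc_regularization {R : realType} {X : topologicalType}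
    {K L : X -> \bar R} {h : X -> R} {a l : R} :
  lsc_regularization K L -> continuous h -> 0 < l ->
  (forall x, a%:E <= (h x)%:E + l%:E * K x)%E ->
  forall x, (a%:E <= (h x)%:E + l%:E * L x)%E.
Proof.
move=> [_ _ Lmax] ch l0 aK x; rewrite (lee_addl_pmul l0).
(* This minorant of [K] is real-valued and continuous, so it competes in the maximality clause
   defining [L]. *)
apply: (Lmax (fun x => ((a - h x) / l)%:E)).
  apply: continuous_lower_semicontinuous => y.
  by apply: cvgM; [apply: cvgB; [exact: cvg_cst|exact: ch]|exact: cvg_cst].
by move=> y; rewrite -(lee_addl_pmul l0).
Qed.

Lemma representation_cost_le (R : realType) (B Theta : Type)
    (f : Theta -> B) (C : Theta -> R) (t : Theta) :
  (representation_cost f C (f t) <= (C t)%:E)%E.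
Proof.
rewrite /representation_cost ifT; last by apply/mem_set; exists t.
by apply: ereal_inf_lbound; exists t.
Qed.

(** Off the range of [f] the cost is [+oo]; on it, the hypothesis bounds every term of the infimum
    over the fibre. With [representation_cost_le], this makes the representation cost the largest
    function whose composite with [f] lies below [C]. *)
Lemma le_representation_cost {R : realType} {B Theta : Type}
    {f : Theta -> B} {C : Theta -> R} {L : B -> \bar R} :
  (forall t, L (f t) <= (C t)%:E)%E ->
  forall g, (L g <= representation_cost f C g)%E.
Proof.
move=> LC g; rewrite /representation_cost; case: ifPn => _; last exact: leey.
by apply: le_ereal_inf_tmp => _ [t <- <-].
Qed.

Theorem theorem3p19 (R : realType) (A : completeNormedModType R)
    (Theta : Type) (f : Theta -> wdual A)
    (C : Theta -> R) (C_ge0 : forall t, 0 <= C t)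
    (Rreg : wdual A -> \bar R)
    (RregP : lsc_regularization (representation_cost f C) Rreg)
    (M : nat) (Aop : {linear wdual A -> 'rV[R]_M}) (Aop_cont : continuous Aop)
    (G : 'rV[R]_M -> R) (G_cont : continuous G)
    (lambda : R) (lambda_gt0 : 0 < lambda) :
  let RTheta := representation_cost f C in
  let FTheta := range f in
  let F := [set g | (Rreg g < +oo)%E] in
  let Jpar := fun t : Theta => (G (Aop (f t)) + lambda * C t)%:E in
  let JTheta := fun g : wdual A => ((G (Aop g))%:E + lambda%:E * RTheta g)%E in
  let J := fun g : wdual A => ((G (Aop g))%:E + lambda%:E * Rreg g)%E in
  [/\ ereal_inf [set Jpar t | t in setT] = ereal_inf [set JTheta g | g in FTheta]
      /\ ereal_inf [set JTheta g | g in FTheta] = ereal_inf [set J g | g in F],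
      forall t, minimizes Jpar setT t -> minimizes J F (f t),
      forall g : wdual A, minimizes J F g -> FTheta g -> Rreg g = RTheta g ->
        minimizes JTheta FTheta g
    & forall g : wdual A, minimizes J F g -> FTheta g -> Rreg g = RTheta g ->
        forall t, f t = g -> (C t)%:E = RTheta g -> minimizes Jpar setT t].

Proof.
move=> RTheta FTheta F Jpar JTheta J.
have [_ Rreg_le _] := RregP.
have Rreg_par t : (Rreg (f t) <= (C t)%:E)%E.
  by apply: le_trans (Rreg_le _) _; exact: representation_cost_le.
have FThetaF g : FTheta g -> F g.
  by move=> [t _ <-]; apply: le_lt_trans (Rreg_par t) _; exact: ltry.
have J_JTheta g : (J g <= JTheta g)%E.
  by rewrite leeD2l// lee_pmul2l ?lte_fin.
have JTheta_Jpar t : (JTheta (f t) <= Jpar t)%E.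
  rewrite /Jpar EFinD EFinM leeD2l// lee_pmul2l ?lte_fin//.
  exact: representation_cost_le.
(* The bound is needed on the whole dual, not only on [FTheta], because regularization compares
   functions on the entire space. *)
have JTheta_ge a : (forall t, (a%:E <= Jpar t)%E) ->
    forall g, (a%:E <= JTheta g)%E.
  move=> aJ g; rewrite (lee_addl_pmul lambda_gt0).
  apply: (le_representation_cost
    (L := fun g => ((a - G (Aop g)) / lambda)%:E)) => t.
  by rewrite -(lee_addl_pmul lambda_gt0) -EFinM -EFinD; exact: aJ.
(* Continuity on [wdual A] is weak* continuity, matching the topology in which [Rreg] is the
   regularization. *)
have GA_continuous : continuous (fun g : wdual A => G (Aop g)).
  by move=> g; exact: (cvg_comp _ _ (Aop_cont g) (G_cont (Aop g))).
have J_ge a : (forall t, (a%:E <= Jpar t)%E) -> forall g, (a%:E <= J g)%E.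
  by move=> /JTheta_ge; exact: (le_lsc_regularization RregP GA_continuous).
have inf_par_J :
    (ereal_inf [set Jpar t | t in setT] <= ereal_inf [set J g | g in F])%E.
  apply: le_ereal_inf_lbound => a aJ _ [g _ <-].
  by apply: J_ge => t; apply: aJ; exists t.
have inf_par_JTheta : (ereal_inf [set Jpar t | t in setT] <=
    ereal_inf [set JTheta g | g in FTheta])%E.
  apply: le_ereal_inf_lbound => a aJ _ [g _ <-].
  by apply: JTheta_ge => t; apply: aJ; exists t.
have inf_JTheta_par : (ereal_inf [set JTheta g | g in FTheta] <=
    ereal_inf [set Jpar t | t in setT])%E.
  apply: le_ereal_inf_tmp => _ [t _ <-]; apply: le_trans (JTheta_Jpar t).
  by apply: ereal_inf_lbound; exists (f t) => //; exists t.
have inf_J_JTheta : (ereal_inf [set J g | g in F] <=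
    ereal_inf [set JTheta g | g in FTheta])%E.
  apply: le_ereal_inf_tmp => _ [g Fg <-]; apply: le_trans (J_JTheta g).
  by apply: ereal_inf_lbound; exists g => //; exact: FThetaF.
split.
- split; apply/le_anti/andP; split => //.
  (* The remaining inequality, from [JTheta] to [J], passes through the parametric infimum. *)
  exact: le_trans inf_JTheta_par inf_par_J.
- move=> t [_ t_min]; split; first by apply: FThetaF; exists t.
  (* By minimality the real number [Jpar t] is a lower bound of [Jpar], so [J_ge] carries it over to
     [J]. *)
  move=> g _; apply: le_trans (J_JTheta _) (le_trans (JTheta_Jpar t) _).
  by apply: J_ge => s; exact: t_min.
- move=> g [_ g_min] gTheta Rg; split => // k kTheta.
  rewrite /JTheta -Rg; apply: le_trans (J_JTheta k).
  by apply: g_min; exact: FThetaF.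
- move=> g [_ g_min] gTheta Rg t ftg Ct; split => // s _.
  (* The two attainment hypotheses turn [Jpar t] into [J g]. *)
  rewrite /Jpar EFinD EFinM Ct -Rg ftg.
  apply: le_trans (le_trans (J_JTheta (f s)) (JTheta_Jpar s)).
  by apply: g_min; apply: FThetaF; exists s.
Qed.
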